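(* Let $r\ge2$, let $\bm{\nu}=(\mu_1,\dots,\mu_{r-1})\in\mathcal{L}_\infty^{r-1}$ be a perfect system, let $\mu_r\in\mathcal{L}_m$ with $m<\infty$, and let $\Phi(x)=\prod_{j=1}^m(x-z_j)$ be the monic orthogonal polynomial of degree $m$ with respect to $\mu_r$. Assume $z_1,\dots,z_m\in\mathbb{C}$ are distinct. Let $\bm{\mu}=(\mu_1,\dots,\mu_{r-1},\mu_r)$ and $\widehat{\bm{\nu}}=(\Phi\mu_1,\dots,\Phi\mu_{r-1})$. Let $P_{\bm{k}}$ and $\widehat P_{\bm{k}}$ denote the monic type II multiple orthogonal polynomials of $\bm{\nu}$ and of $\widehat{\bm{\nu}}$. (i) Let $\bm{k}\in\mathbb{N}^{r-1}$. If $(\bm{k},m)$ is normal for $\bm{\mu}$, then for any sequence $\{\bm{s}_j\}_{j=0}^m$ in $\mathbb{N}^{r-1}$ with $\bm{s}_0=\bm{0}$ and $|\bm{s}_j|=j$ we have $D_{\bm{k}}:=\det\big(P_{\bm{k}+\bm{s}_{m-i}}(z_j)\big)_{i,j=1}^m\neq0$ and $$\widehat{P}_{\bm{k}}(x)=\Phi(x)^{-1}D_{\bm{k}}^{-1}\det\begin{pmatrix}P_{\bm{k}+\bm{s}_m}(x)&P_{\bm{k}+\bm{s}_{m-1}}(x)&\cdots&P_{\bm{k}}(x)\\P_{\bm{k}+\bm{s}_m}(z_1)&P_{\bm{k}+\bm{s}_{m-1}}(z_1)&\cdots&P_{\bm{k}}(z_1)\\\vdots&\vdots&\ddots&\vdots\\P_{\bm{k}+\bm{s}_m}(z_m)&P_{\bm{k}+\bm{s}_{m-1}}(z_m)&\cdots&P_{\bm{k}}(z_m)\end{pmatrix}.$$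 (ii) If $D_{\bm{k}}=\det\big(P_{\bm{k}+\bm{s}_{m-i}}(z_j)\big)_{i,j=1}^m\ne0$ for every $\bm{k}\in\mathbb{N}^{r-1}$ and every sequence $\{\bm{s}_j\}_{j=0}^m$ in $\mathbb{N}^{r-1}$ with $\bm{s}_0=\bm{0}$ and $|\bm{s}_j|=j$, then $\widehat{\bm{\nu}}$ is perfect.
   Context: $\mathbb{N}=\{0,1,2,\dots\}$. A moment functional is a linear map $\mu:\mathbb{C}[x]\to\mathbb{C}$; put $\Delta_n=\det(\mu[x^{i+k}])_{i,k=0}^{n-1}$. For $N\in\{1,2,\dots\}$, $\mathcal{L}_N$ is the set of $\mu$ with $\Delta_n\ne0$ for $1\le n\le N$ and $\Delta_n=0$ for $n>N$; $\mathcal{L}_\infty$ is the set of $\mu$ with $\Delta_n\neq0$ for all $n$. For $\mu\in\mathcal L_m$ the monic orthogonal polynomial of degree $m$ is the unique monic $P$ of degree $m$ with $\mu[P(x)x^p]=0$ for $0\le p\le m-1$. For a polynomial $\Phi$, the Christoffel transform $\Phi\mu$ is the moment functional $f\mapsto\mu[\Phi f]$. For a system $(\mu_1,\dots,\mu_s)$ of moment functionals and $\bm{n}\in\mathbb{N}^s$, $|\bm{n}|=n_1+\dots+n_s$, a type II multiple orthogonal polynomial at $\bm{n}$ is a nonzero polynomial $P$ with $\deg P\le|\bm{n}|$ and $\mu_j[P(x)x^p]=0$ for $0\le p\le n_j-1$, $1\le j\le s$. The index $\bm{n}$ is normal if every such $P$ has degree exactly $|\bm{n}|$; then there is a unique monic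 one, denoted $P_{\bm{n}}$. ($\bm{0}$ is always normal.) In this statement the systems $\bm\nu$, $\widehat{\bm\nu}$ of $r-1$ functionals are called perfect if every index in $\mathbb{N}^{r-1}$ is normal for them. If $(\bm{k},m)$ is normal for $\bm{\mu}$ then $\bm{k}$ is normal for $\widehat{\bm{\nu}}$, so $\widehat P_{\bm k}$ in (i) is well defined. *)

(* Defs.v *)
From HB Require Import structures.
From mathcomp Require Import all_boot all_order all_algebra.
From mathcomp Require Import boolp classical_sets reals complex.
Set Implicit Arguments.
Unset Strict Implicit.
Unset Printing Implicit Defensive.
Import Order.TTheory GRing.Theory Num.Theory.
Local Open Scope ring_scope.

Section MomentFunctionals.
Variable F : fieldType.
Implicit Types (mu : {scalar {poly F}}) (P Phi : {poly F}).

Definition hankel_det mu (n : nat) : F :=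
  \det (\matrix_(i < n, k < n) mu 'X^(i + k)).

Definition in_L (N : nat) mu : Prop :=
  [/\ (0 < N)%N,
      forall n : nat, (1 <= n <= N)%N -> hankel_det mu n != 0 &
      forall n : nat, (N < n)%N -> hankel_det mu n = 0].

Definition in_L_infty mu : Prop := forall n : nat, hankel_det mu n != 0.

Definition is_monic_op mu (m : nat) P : Prop :=
  [/\ P \is monic, size P = m.+1 &
      forall p : nat, (p < m)%N -> mu (P * 'X^p) = 0].

Definition christoffel Phi mu : {poly F} -> F := fun f => mu (Phi * f).

Fact christoffel_is_scalar Phi mu : scalar (christoffel Phi mu).
Proof. by move=> a f g; rewrite /christoffel mulrDr -scalerAr linearP. Qed.

HB.instance Definition _ Phi mu :=
  GRing.isLinear.Build F {poly F} F *%R (christoffel Phi mu)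
    (christoffel_is_scalar Phi mu).

End MomentFunctionals.

Section MultipleOrthogonality.
Variables (F : fieldType) (s : nat).
Implicit Types (mu : 'I_s -> {scalar {poly F}}) (n : {ffun 'I_s -> nat}).
Implicit Types P : {poly F}.

Definition idx_size n : nat := (\sum_(j < s) n j)%N.

Definition is_type_II mu n P : Prop :=
  [/\ P != 0, (size P <= (idx_size n).+1)%N &
      forall (j : 'I_s) (p : nat), (p < n j)%N -> mu j (P * 'X^p) = 0].

Definition normal_idx mu n : Prop :=
  forall P, is_type_II mu n P -> size P = (idx_size n).+1.

Definition perfect mu : Prop := forall n, normal_idx mu n.

(* The value is meaningful at normal indices only, by [mopP] and [mop_unique];
   elsewhere it is an arbitrary monic solution, or 0 if there is none. *)
Definition mop mu n : {poly F} :=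
  xget 0 [set P : {poly F} | is_type_II mu n P /\ P \is monic]%classic.

Lemma type_II_exists mu n : exists P, is_type_II mu n P.
Proof.
pose B (j : 'I_s) : 'M[F]_((idx_size n).+1, n j) :=
  \matrix_(i, p) mu j ('X^(i + p)).
have [|u /sub_kermxP uB u0] := @rowV0Pn _ _ _ (kermx (\mxrow_j B j)) _.
  rewrite kermx_eq0 /row_free neq_ltn ltnS; apply/orP; left.
  exact: rank_leq_col.
exists (rVpoly u); split.
- by apply: contraNneq u0 => u0; rewrite -[u]rVpolyK u0 linear0.
- exact: size_poly.
move=> j p pn; move: uB; rewrite mul_mxrow -[RHS]mxrow0.
move/eq_mxrowP => /(_ j) /matrixP /(_ ord0 (Ordinal pn)); rewrite !mxE => <-.
rewrite /rVpoly poly_def mulr_suml linear_sum; apply: eq_bigr => i _.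
by rewrite valK -scalerAl linearZ /= mxE exprD.
Qed.

Lemma mopP mu n : normal_idx mu n ->
  [/\ is_type_II mu n (mop mu n), mop mu n \is monic &
      size (mop mu n) = (idx_size n).+1].
Proof.
move=> nn; have [P [P0 sP oP]] := type_II_exists mu n.
have lP : lead_coef P != 0 by rewrite lead_coef_eq0.
suff [tM mM] : is_type_II mu n (mop mu n) /\ mop mu n \is monic.
  by split=> //; exact: nn.
rewrite /mop; apply: (@xgetPex _ 0
  [set Q : {poly F} | is_type_II mu n Q /\ Q \is monic]%classic).
exists ((lead_coef P)^-1 *: P); split; last first.
  by rewrite monicE lead_coefZ mulVf.
split=> [||j p pn].
- by rewrite scaler_eq0 invr_eq0 negb_or lP.
- by rewrite size_scale ?invr_eq0.
- by rewrite -scalerAl linearZ /= oP // mulr0.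
Qed.

Lemma mop_unique mu n P : normal_idx mu n ->
  is_type_II mu n P -> P \is monic -> P = mop mu n.
Proof.
move=> nn tP mP; have [tQ mQ sQ] := mopP nn; have sP := nn _ tP.
set Q := mop mu n in tQ mQ sQ *.
apply/eqP; rewrite -subr_eq0; apply/negPn/negP => d0.
have dl : (size (P - Q)%R <= (idx_size n))%N.
  apply/leq_sizeP => i; rewrite leq_eqVlt => /predU1P[<-|li].
    move: mP mQ; rewrite !monicE /lead_coef sP sQ coefB => /eqP-> /eqP->.
    by rewrite subrr.
  by rewrite coefB !nth_default ?subrr ?sP ?sQ.
suff /nn sD : is_type_II mu n (P - Q) by rewrite sD ltnn in dl.
split=> // [|j p pn]; first exact: leqW.
case: tP tQ => _ _ oP [_ _ oQ].
by rewrite mulrBl linearB /= oP // oQ // subrr.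
Qed.

End MultipleOrthogonality.

Definition rcons_ord (T : Type) (n : nat) (f : 'I_n -> T) (a : T) :
  'I_n.+1 -> T := fun i => oapp f a (unlift ord_max i).

Definition cons_ord (T : Type) (n : nat) (a : T) (f : 'I_n -> T) :
  'I_n.+1 -> T := fun i => oapp f a (unlift ord0 i).

Section ChristoffelDeterminants.
Variables (F : fieldType) (s m : nat).
Implicit Types (nu : 'I_s -> {scalar {poly F}}) (k : {ffun 'I_s -> nat}).
(* Of a sequence [t] only the terms [t 0, ..., t m] are ever used. *)
Implicit Types (t : nat -> {ffun 'I_s -> nat}) (z : 'I_m -> F).

Definition admissible_seq t : Prop :=
  t 0%N = 0 /\ forall j : nat, (j <= m)%N -> idx_size (t j) = j.

(* [i] and [j] are 0-based, whence [m - i.+1]. *)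
Definition christoffel_D nu z k t : F :=
  \det (\matrix_(i < m, j < m) (mop nu (k + t (m - i.+1)%N)).[z j]).

Definition christoffel_det nu z k t (x : F) : F :=
  \det (\matrix_(i < m.+1, j < m.+1)
    (mop nu (k + t (m - j)%N)).[cons_ord x z i]).

End ChristoffelDeterminants.
Arguments admissible_seq {s} m t.

(* Main.v *)
(* For a perfect system the polynomials [P_(k + s_j)], [j < m], form a basis of
   the polynomials of degree [< |k| + m] orthogonal at [k]. Since the zeros
   [z_j] of [Phi] are distinct, [D_k] vanishes exactly when some nonzero such
   polynomial is divisible by [Phi], i.e. when the Christoffel-transformed
   system has a type II polynomial at [k] of too small a degree; this is (ii).
   As [Phi * mu_r] is the zero functional, multiples of [Phi] orthogonal at [k]
   are orthogonal at [(k, m)], so normality of [(k, m)] forces [D_k != 0]. The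
   determinant in (i), as a polynomial in [x], vanishes at each [z_j], hence is
   [Phi * Q], with [Q] of type II for the transformed system at [k] and leading
   coefficient [D_k]. *)

Require Import Defs.
From HB Require Import structures.
From mathcomp Require Import all_boot all_order all_algebra.
From mathcomp Require Import zify.
From mathcomp Require Import boolp classical_sets reals complex.
Set Implicit Arguments.
Unset Strict Implicit.
Unset Printing Implicit Defensive.
Import Order.TTheory GRing.Theory Num.Theory.
Local Open Scope ring_scope.

(** * Functionals with finitely many nonzero Hankel determinants *)

Section FiniteFunctionals.
Variable F : fieldType.
Implicit Types (mu : {scalar {poly F}}) (P Q Phi : {poly F}).

Lemma moment_mul mu P Q :
  mu (P * Q) = \sum_(i < size Q) Q`_i * mu (P * 'X^i).
Proof.
rewrite -{1}(coefK Q) poly_def mulr_sumr linear_sum; apply: eq_bigr => i _.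
by rewrite -scalerAr linearZ.
Qed.

Lemma moment_mul_eq0 mu P Q n :
    (forall p, (p < n)%N -> mu (P * 'X^p) = 0) -> (size Q <= n)%N ->
  mu (P * Q) = 0.
Proof.
move=> P0 sQ; rewrite moment_mul big1 // => i _.
by rewrite P0 ?mulr0 // (leq_trans _ sQ).
Qed.

(** A vector in the left kernel of the Hankel matrix is the coefficient vector of [P]: its product
    with column [p] is [mu (P * 'X^p)]. *)
Lemma hankel_det_eq0P mu n :
  reflect (exists P, [/\ P != 0, (size P <= n)%N &
             forall p, (p < n)%N -> mu (P * 'X^p) = 0])
          (hankel_det mu n == 0).
Proof.
have E (v : 'rV[F]_n) (p : 'I_n) :
    (v *m \matrix_(i < n, k < n) mu 'X^(i + k)) ord0 p
      = mu (rVpoly v * 'X^p).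
  rewrite !mxE /rVpoly poly_def mulr_suml linear_sum; apply: eq_bigr => i _.
  by rewrite valK -scalerAl linearZ /= mxE exprD.
apply: (iffP det0P) => [[v v0 vA]|[P [P0 sP oP]]].
  exists (rVpoly v); split=> [||p pn].
  - by apply: contraNneq v0 => v0; rewrite -[v]rVpolyK v0 linear0.
  - exact: size_poly.
  - by rewrite -(E v (Ordinal pn)) vA mxE.
have PK : rVpoly (poly_rV P : 'rV_n) = P by apply: poly_rV_K.
exists (poly_rV P); first by apply: contraNneq P0 => P0; rewrite -PK P0 linear0.
by apply/rowP => p; rewrite E PK mxE oP.
Qed.

(* By induction on [n], [mu (Phi * 'X^n) = 0]: the Hankel determinant of order
   [n.+1] vanishes, hence some [P != 0] with [size P <= n.+1] is orthogonal to
   all [f] with [size f <= n.+1]. Its remainder modulo [Phi] is orthogonal to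
   degrees [< m], hence 0, and testing [P = A * Phi] against a suitable power
   of ['X] isolates [lead_coef A * mu (Phi * 'X^n)]. *)
Lemma in_L_annihilator mu m Phi Q :
  in_L m mu -> is_monic_op mu m Phi -> mu (Phi * Q) = 0.
Proof.
move=> [m0 nz z0] [mPhi sPhi oPhi].
suff oX n : mu (Phi * 'X^n) = 0 by apply: (@moment_mul_eq0 _ _ _ (size Q)).
have [n' le_nn'] := ubnP n; elim: n' n le_nn' => // n' IH n; rewrite ltnS => le_n.
have {le_n}IH p : (p < n)%N -> mu (Phi * 'X^p) = 0.
  by move=> pn; apply: IH; apply: leq_trans le_n.
have [/oPhi //|le_mn] := ltnP n m.
have /eqP/hankel_det_eq0P[P [P0 sP oP]] := z0 n.+1 le_mn.
have [A [B [DP sA sB]]] : exists A B : {poly F},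
    [/\ P = A * Phi + B, (size A <= n.+1 - m)%N & (size B <= m)%N].
  have Phi0 : Phi != 0 by apply: monic_neq0.
  exists (P %/ Phi), (P %% Phi); split; first exact: divp_eq.
    by rewrite size_divp // sPhi /= leq_sub2r.
  by rewrite -ltnS -sPhi ltn_modp.
have B0 : B = 0.
  apply: contraTeq (nz m _) => [B0|]; last by rewrite m0 leqnn.
  apply/negPn/hankel_det_eq0P; exists B; split=> // p pm.
  have := oP p (leq_trans pm (leqW le_mn)).
  rewrite DP mulrDl linearD /= -mulrA mulrCA (moment_mul_eq0 IH) ?add0r //.
  have [->|A0] := eqVneq A 0; first by rewrite mul0r size_poly0.
  by rewrite size_mulXn //; lia.
have DPA : P = A * Phi by rewrite DP B0 addr0.
have A0 : A != 0 by apply: contraNneq P0 => A0; rewrite DPA A0 mul0r.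
have sA0 : (0 < size A)%N by rewrite size_poly_gt0.
have := oP (n.+1 - size A)%N; rewrite ltnS leq_subLR => /(_ _) oPA.
have {oPA} := oPA (leq_add sA0 (leqnn n)).
have sAX : size (A * 'X^(n.+1 - size A)) = n.+1 by rewrite size_mulXn //; lia.
rewrite DPA -mulrA mulrCA (moment_mul mu Phi (_ * _)) sAX big_ord_recr /=.
rewrite big1 => [|i _]; last by rewrite IH ?mulr0.
rewrite add0r => /eqP; rewrite mulf_eq0 => /orP[|/eqP //].
have -> : (A * 'X^(n.+1 - size A))`_n = lead_coef A.
  by rewrite coefMXn ifN; [congr (_`_ _); lia | lia].
by rewrite lead_coef_eq0 (negPf A0).
Qed.

End FiniteFunctionals.

(** The degrees increase strictly, so the top coefficient of the sum isolates the last scalar;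
    induction then removes that term. *)
Lemma staircase_free (F : fieldType) (n a : nat) (p : 'I_n -> {poly F})
    (c : 'I_n -> F) :
    (forall i, size (p i) = (a + i).+1) -> \sum_(i < n) c i *: p i = 0 ->
  forall i, c i = 0.
Proof.
elim: n p c => [|n IH] p c sp; first by move=> _ [].
rewrite big_ord_recr /= => S0.
have cn : c ord_max = 0.
  have /(congr1 (fun q : {poly F} => q`_(a + n))) := S0.
  rewrite coefD coef_sum big1 => [|i _]; last first.
    by rewrite coefZ nth_default ?mulr0 // sp /= ltn_add2l.
  rewrite add0r coefZ coef0 => /eqP; rewrite mulf_eq0 => /orP[/eqP //|].
  have -> : (a + n = (size (p ord_max)).-1)%N by rewrite sp.
  by rewrite -lead_coefE lead_coef_eq0 -size_poly_eq0 sp.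
move: S0; rewrite cn scale0r addr0 => S0.
have {}IH := IH _ _ (fun i => sp (widen_ord (leqnSn n) i)) S0.
move=> i; have [j ->|-> //] := unliftP ord_max i.
by rewrite -(IH j); congr c; apply/val_inj/lift_max.
Qed.

(** * Polynomials orthogonal at an index of a perfect system *)

Section Orthogonality.
Variables (F : fieldType) (s : nat).
Implicit Types (nu : 'I_s -> {scalar {poly F}}) (k n : {ffun 'I_s -> nat}).
Implicit Types P Q Phi : {poly F}.

Definition orthogonal_at nu n P : Prop :=
  forall (j : 'I_s) (p : nat), (p < n j)%N -> nu j (P * 'X^p) = 0.

Lemma orthogonal_at_lincomb nu n (I : finType) (c : I -> F)
    (p : I -> {poly F}) :
  (forall i, orthogonal_at nu n (p i)) ->
  orthogonal_at nu n (\sum_i c i *: p i).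
Proof.
move=> op j q qn; rewrite mulr_suml linear_sum big1 // => i _.
by rewrite -scalerAl linearZ /= op ?mulr0.
Qed.

Lemma orthogonal_at_christoffel nu n Phi Q :
  orthogonal_at (fun j => christoffel Phi (nu j)) n Q <->
  orthogonal_at nu n (Phi * Q).
Proof. by split=> o j p /o; rewrite /= /christoffel mulrA. Qed.

Lemma idx_sizeD k n : idx_size (k + n) = (idx_size k + idx_size n)%N.
Proof.
by rewrite /idx_size -big_split /=; apply: eq_bigr => j _; rewrite ffunE.
Qed.

Lemma size_mop nu n : perfect nu -> size (mop nu n) = (idx_size n).+1.
Proof. by move=> pnu; case: (mopP (pnu n)). Qed.

Lemma mop_monic nu n : perfect nu -> mop nu n \is monic.
Proof. by move=> pnu; case: (mopP (pnu n)). Qed.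

Lemma orthogonal_at_mop nu k n :
  perfect nu -> orthogonal_at nu k (mop nu (k + n)).
Proof.
move=> pnu j p pk; have [[_ _ o] _ _] := mopP (pnu (k + n)).
by apply: o; rewrite ffunE (leq_trans pk) // leq_addr.
Qed.

(** Each step cancels the top coefficient with a multiple of the monic [mop nu (k + t n)]. What
    remains at [n = 0] has degree below [idx_size k], so normality of [k] forces it to be 0. *)
Lemma orthogonal_at_span nu k (t : nat -> {ffun 'I_s -> nat}) (n : nat) P :
    perfect nu -> (forall j, (j < n)%N -> idx_size (t j) = j) ->
    orthogonal_at nu k P -> (size P <= idx_size k + n)%N ->
  exists c : 'I_n -> F, P = \sum_(i < n) c i *: mop nu (k + t i).
Proof.
move=> pnu; elim: n P => [|n IH] P ts oP sP.
  exists (fun=> 0); rewrite big_ord0; apply/eqP/negPn/negP => P0.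
  rewrite addn0 in sP.
  have /pnu sP' : is_type_II nu k P by split=> //; apply: leqW.
  by rewrite sP' ltnn in sP.
set M := mop nu (k + t n); set a := P`_(idx_size k + n).
have sM : size M = (idx_size k + n).+1 by rewrite size_mop // idx_sizeD ts.
have oM : orthogonal_at nu k M by exact: orthogonal_at_mop.
have [|||c Dc] := IH (P - a *: M).
- by move=> j jn; apply: ts; apply: leqW.
- move=> j p pk; rewrite mulrBl linearB /= -scalerAl linearZ /= oP //.
  by rewrite oM // mulr0 subrr.
- apply/leq_sizeP => i; rewrite leq_eqVlt => /predU1P[<-|li]; rewrite coefB coefZ.
    have /monicP : M \is monic by apply: mop_monic.
    by rewrite lead_coefE sM /= => ->; rewrite mulr1 subrr.
  by rewrite !nth_default ?mulr0 ?subrr // ?sM // (leq_trans sP) // addnS.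
exists (fun i => oapp c a (unlift ord_max i)).
rewrite big_ord_recr /= unlift_none /= -/M -[LHS](subrK (a *: M)) Dc.
congr (_ + _); apply: eq_bigr => i _.
have wi : widen_ord (leqnSn n) i = lift ord_max i.
  exact/val_inj/esym/lift_max.
by rewrite wi liftK.
Qed.

Lemma idx_size_rcons k m :
  idx_size [ffun i => rcons_ord k m i] = (idx_size k + m)%N.
Proof.
rewrite /idx_size big_ord_recr /= ffunE /rcons_ord unlift_none /=.
congr (_ + _)%N; apply: eq_bigr => i _; rewrite ffunE.
suff -> : widen_ord (leqnSn s) i = lift ord_max i by rewrite liftK.
exact/val_inj/esym/lift_max.
Qed.

(** The conditions on the last functional are free, since [mu_r] kills every multiple of [Phi]. This
    carries polynomials found for [nu] over to the extended system. *)
Lemma is_type_II_rcons nu (mu_r : {scalar {poly F}}) k m Phi P :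
    (forall f, mu_r (Phi * f) = 0) -> Phi %| P ->
    P != 0 -> (size P <= (idx_size k + m).+1)%N -> orthogonal_at nu k P ->
  is_type_II (rcons_ord nu mu_r) [ffun i => rcons_ord k m i] P.
Proof.
move=> kPhi /dvdpP[Q DP] P0 sP oP; split=> // [|j p].
  by rewrite idx_size_rcons.
rewrite ffunE /rcons_ord; case: unliftP => [i _|_] /=; first exact: oP.
by move=> _; rewrite DP mulrAC mulrC.
Qed.

End Orthogonality.

Lemma dvdp_prod_XsubC (F : fieldType) (m : nat) (z : 'I_m -> F) (P : {poly F}) :
  injective z ->
  reflect (forall j, P.[z j] = 0) (\prod_(j < m) ('X - (z j)%:P) %| P).
Proof.
move=> z_inj; apply: (iffP idP) => [/dvdpP[Q ->] j|Pz].
  rewrite hornerM (bigD1 j) //= hornerM hornerXsubC subrr mul0r mulr0 //.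
rewrite -(big_map z xpredT (fun x => 'X - x%:P)); apply: uniq_roots_dvdp.
  by apply/allP => _ /mapP[j _ ->]; apply/rootP.
by rewrite uniq_rootsE map_inj_uniq // index_enum_uniq.
Qed.

(** * Christoffel determinants and the transformed system *)

Section ChristoffelTransform.
Variables (F : fieldType) (s m : nat) (nu : 'I_s -> {scalar {poly F}}).
Variables (z : 'I_m -> F) (k : {ffun 'I_s -> nat}).
Variable t : nat -> {ffun 'I_s -> nat}.
Hypotheses (nu_perfect : perfect nu) (z_inj : injective z).
Hypothesis t_adm : admissible_seq m t.

Let Phi : {poly F} := \prod_(j < m) ('X - (z j)%:P).
Let nu_hat (j : 'I_s) : {scalar {poly F}} := christoffel Phi (nu j).

Let Phi_monic : Phi \is monic. Proof. exact: monic_prod_XsubC. Qed.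

Let size_Phi : size Phi = m.+1.
Proof.
by rewrite size_prod_XsubC [index_enum _]unlock -enumT size_enum_ord.
Qed.

Let size_mop_t j : (j <= m)%N -> size (mop nu (k + t j)) = (idx_size k + j).+1.
Proof. by move=> jm; case: t_adm => _ st; rewrite size_mop // idx_sizeD st. Qed.

(** The map [S] sends row vectors bijectively to the polynomials of degree below [idx_size k + m]
    orthogonal at [k]. Multiplying [v] by the matrix evaluates [S v] at the [z j], so kernel vectors
    match multiples of [Phi]. *)
Lemma christoffel_D_eq0P :
  reflect (exists P : {poly F}, [/\ P != 0, (size P <= idx_size k + m)%N,
             orthogonal_at nu k P & Phi %| P])
          (christoffel_D nu z k t == 0).
Proof.
pose S (v : 'rV[F]_m) := \sum_(i < m) v ord0 i *: mop nu (k + t (m - i.+1)%N).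
have E (v : 'rV[F]_m) j : (v *m \matrix_(i < m, j < m)
    (mop nu (k + t (m - i.+1)%N)).[z j]) ord0 j = (S v).[z j].
  by rewrite mxE horner_sum; apply: eq_bigr => i _; rewrite mxE hornerZ.
apply: (iffP det0P) => [[v v0 vM]|[P [P0 sP oP PhiP]]].
  exists (S v); split.
  (* The rows are listed by decreasing degree; [rev_ord] restores the increasing order that
     [staircase_free] expects. *)
  - apply: contra_neq v0; rewrite /S (reindex_inj rev_ord_inj) /= => S0.
    apply/rowP => i; rewrite mxE -(rev_ordK i).
    apply: (staircase_free (a := idx_size k) _ S0) => {}i.
    by have := ltn_ord i; rewrite size_mop_t /=; lia.
  - rewrite (leq_trans (size_sum _ _ _)) //; apply/bigmax_leqP => i _.
    by rewrite (leq_trans (size_scale_leq _ _)) // size_mop_t; have := ltn_ord i; lia.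
  - by apply: orthogonal_at_lincomb => i; apply: orthogonal_at_mop.
  - by apply/dvdp_prod_XsubC => // j; rewrite -E vM mxE.
have [|c Dc] := orthogonal_at_span (t := t) nu_perfect _ oP sP.
  by move=> j jm; case: t_adm => _ -> //; apply: ltnW.
pose v := \row_i c (rev_ord i).
have Sv : S v = P.
  rewrite Dc /S (reindex_inj rev_ord_inj) /=; apply: eq_bigr => i _.
  by rewrite mxE rev_ordK /=; congr (_ *: mop _ (_ + t _)); have := ltn_ord i; lia.
exists v; last by apply/rowP => j; rewrite E Sv mxE; apply/dvdp_prod_XsubC: j.
apply: contraNneq P0 => v0.
by rewrite -Sv v0 /S big1 // => i _; rewrite mxE scale0r.
Qed.

Lemma christoffel_normal : christoffel_D nu z k t != 0 -> normal_idx nu_hat k.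
Proof.
move/christoffel_D_eq0P => noP Q [Q0 sQ oQ]; apply/eqP; rewrite eqn_leq sQ /=.
rewrite ltnNge; apply/negP => sQ'; apply: noP; exists (Phi * Q); split.
- by rewrite mulf_neq0 // monic_neq0.
- by rewrite size_monicM // size_Phi addSn addnC leq_add2r.
- exact/orthogonal_at_christoffel.
- exact: dvdp_mulIl.
Qed.

Lemma christoffel_det_poly : exists H : {poly F},
  [/\ forall x, H.[x] = christoffel_det nu z k t x, orthogonal_at nu k H,
      (size H <= (idx_size k + m).+1)%N,
      H`_(idx_size k + m) = christoffel_D nu z k t & Phi %| H].
Proof.
pose A x := \matrix_(i < m.+1, j < m.+1)
  (mop nu (k + t (m - j)%N)).[cons_ord x z i].
(* Laplace expansion along the first row, the only one containing [x]; the cofactors do not see it,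
   so the 0 in [A 0] is arbitrary. *)
pose H := \sum_(j < m.+1) cofactor (A 0) ord0 j *: mop nu (k + t (m - j)%N).
have HE x : H.[x] = christoffel_det nu z k t x.
  rewrite /christoffel_det -/(A x) (expand_det_row _ ord0) horner_sum.
  apply: eq_bigr => j _; rewrite hornerZ mulrC mxE /cons_ord unlift_none /=.
  congr (_ * (_ * \det _)); apply/matrixP => a b.
  by rewrite !mxE /cons_ord liftK.
exists H; split=> //.
- by apply: orthogonal_at_lincomb => i; apply: orthogonal_at_mop.
- rewrite (leq_trans (size_sum _ _ _)) //; apply/bigmax_leqP => i _.
  by rewrite (leq_trans (size_scale_leq _ _)) // size_mop_t; have := ltn_ord i; lia.
(* Only column 0 reaches degree [idx_size k + m]; its cofactor is the determinant of the transpose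
   of the matrix of [christoffel_D]. *)
- rewrite /H big_ord_recl coefD coef_sum big1 ?addr0 => [|i _]; last first.
    by rewrite coefZ nth_default ?mulr0 // size_mop_t /= /bump /=; have := ltn_ord i; lia.
  have sm : size (mop nu (k + t (m - 0)%N)) = (idx_size k + m).+1.
    by rewrite subn0 size_mop_t.
  have /monicP := mop_monic (k + t (m - 0)%N) nu_perfect.
  rewrite coefZ lead_coefE sm /= => ->; rewrite mulr1 /cofactor expr0 mul1r.
  rewrite -det_tr; congr (\det _); apply/matrixP => a b.
  by rewrite !mxE /cons_ord liftK /=.
(* At [x = z j] the first row coincides with row [j + 1]. *)
- apply/dvdp_prod_XsubC => // j; rewrite HE.
  apply: (@determinant_alternate _ _ _ ord0 (lift ord0 j)) => // b.
  by rewrite !mxE /cons_ord unlift_none liftK.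
Qed.

(** The quotient by [Phi] is taken pointwise. At a zero of [Phi] the right side would be 0 because
    [0^-1 = 0], whence the restriction on [x]. *)
Lemma mop_christoffel x :
    christoffel_D nu z k t != 0 -> Phi.[x] != 0 ->
  (mop nu_hat k).[x] =
    Phi.[x]^-1 * (christoffel_D nu z k t)^-1 * christoffel_det nu z k t x.
Proof.
set D := christoffel_D nu z k t => D0 Phix0.
have [H [HE oH sH cH /dvdpP[Q DH]]] := christoffel_det_poly.
have H0 : H != 0 by apply: contraNneq D0 => H0; rewrite /D -cH H0 coef0.
have Q0 : Q != 0 by apply: contraNneq H0 => Q0; rewrite DH Q0 mul0r.
have sHk : size H = (idx_size k + m).+1.
  apply/eqP; rewrite eqn_leq sH ltnNge; apply: contra D0 => sH'.
  by rewrite /D -cH nth_default.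
have sQ : size Q = (idx_size k).+1.
  move: sHk; rewrite DH size_Mmonic // size_Phi; lia.
have lQ : lead_coef Q = D.
  by rewrite -(lead_coef_Mmonic Q Phi_monic) -DH lead_coefE sHk.
have -> : mop nu_hat k = D^-1 *: Q.
  apply/esym/mop_unique; first exact: christoffel_normal.
    split=> [||j p pk].
    - by rewrite scaler_eq0 invr_eq0 negb_or D0.
    - by rewrite size_scale ?invr_eq0 // sQ.
    - rewrite -scalerAl linearZ /=.
      have /orthogonal_at_christoffel oQ : orthogonal_at nu k (Phi * Q).
        by rewrite mulrC -DH.
      by rewrite oQ ?mulr0.
  by rewrite monicE lead_coefZ lQ mulVf.
rewrite -HE DH hornerZ hornerM [Phi.[x]^-1 * _]mulrC -mulrA.
by rewrite [Q.[x] * _]mulrC mulKf.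
Qed.

End ChristoffelTransform.

(** Supplies a sequence at which to use the hypothesis of (ii); all its growth is in the first
    coordinate, which exists because [r >= 2]. *)
Lemma admissible_seq_exists (s m : nat) :
  (0 < s)%N -> exists t : nat -> {ffun 'I_s -> nat}, admissible_seq m t.
Proof.
move=> s0; exists (fun n => [ffun i => if i == Ordinal s0 then n else 0%N]).
split=> [|j _]; first by apply/ffunP => i; rewrite !ffunE; case: ifP.
rewrite /idx_size (bigD1 (Ordinal s0)) //= ffunE eqxx big1 ?addn0 // => i.
by rewrite ffunE => /negPf->.
Qed.

Theorem theorem3p2 (R : realType) (r : nat) (hr : (2 <= r)%N)
  (nu : 'I_r.-1 -> {scalar {poly R[i]}})
  (hnu : forall j : 'I_r.-1, in_L_infty (nu j)) (nu_perfect : perfect nu)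
  (m : nat) (mu_r : {scalar {poly R[i]}}) (hmu_r : in_L m mu_r)
  (Phi : {poly R[i]}) (hPhi : is_monic_op mu_r m Phi)
  (z : 'I_m -> R[i]) (Phi_z : Phi = \prod_(j < m) ('X - (z j)%:P))
  (z_inj : injective z) :
  let mu : 'I_r.-1.+1 -> {scalar {poly R[i]}} := rcons_ord nu mu_r in
  let nu_hat : 'I_r.-1 -> {scalar {poly R[i]}} :=
    fun j => christoffel Phi (nu j) in
  (forall k : {ffun 'I_r.-1 -> nat},
     normal_idx mu [ffun i => rcons_ord k m i] ->
     forall t : nat -> {ffun 'I_r.-1 -> nat}, admissible_seq m t ->
       christoffel_D nu z k t != 0 /\
       forall x : R[i], Phi.[x] != 0 ->
         (mop nu_hat k).[x] =
           Phi.[x]^-1 * (christoffel_D nu z k t)^-1 *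
           christoffel_det nu z k t x) /\
  ((forall (k : {ffun 'I_r.-1 -> nat}) (t : nat -> {ffun 'I_r.-1 -> nat}),
      admissible_seq m t -> christoffel_D nu z k t != 0) ->
   perfect nu_hat).
Proof.
move=> mu nu_hat; have s_gt0 : (0 < r.-1)%N by rewrite -subn1 subn_gt0.
subst Phi; split=> [k kn t ta|DN k].
  have D0 : christoffel_D nu z k t != 0.
    (* If [D_k] vanished, [P] would be of type II at [(k, m)] with degree below [idx_size k + m],
       against normality. *)
    apply/negP => /(christoffel_D_eq0P k nu_perfect z_inj ta)[P [P0 sP oP PhiP]].
    have := is_type_II_rcons (fun f => in_L_annihilator f hmu_r hPhi)
      PhiP P0 (leqW sP) oP.
    by move=> /kn; rewrite idx_size_rcons => sP'; rewrite sP' ltnn in sP.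
  by split=> // x; apply: mop_christoffel.
have [t ta] := admissible_seq_exists m s_gt0.
exact: christoffel_normal (DN k t ta).
Qed.
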